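(* Let $W=\{(W_i,\omega_i)\}_{i\in I}$ be a fusion frame of a separable Hilbert space $\mathcal{H}$. Then there exists a non canonical $Q$-dual fusion frame $V=\{(V_i,\omega_i)\}_{i\in I}$ of $W$ (that is, a $Q$-dual fusion frame, with the same weights $\omega_i$, different from the canonical dual $\widetilde{W}=\{(S_W^{-1}W_i,\omega_i)\}_{i\in I}$) such that $e(V)=e(W)$.
   Context: All index sets are countable. A family $W=\{(W_i,\omega_i)\}_{i\in I}$ of closed subspaces $W_i\subseteq\mathcal{H}$ and weights $\omega_i>0$ is a fusion frame for $\mathcal{H}$ if there are $0<A\le B<\infty$ with $A\|f\|^2\le\sum_{i\in I}\omega_i^2\|\pi_{W_i}f\|^2\le B\|f\|^2$ for all $f\in\mathcal{H}$, where $\pi_{W_i}$ is the orthogonal projection onto $W_i$. $\bigoplus_{i\in I}W_i$ denotes the Hilbert space of sequences $\{f_i\}_{i\in I}$ with $f_i\in W_i$ and $\sum_i\|f_i\|^2<\infty$. The synthesis operator is $T_W:\bigoplus_{i\in I}W_i\to\mathcal{H}$, $T_W\{f_i\}=\sum_i\omega_i f_i$, with adjoint $T_W^*f=\{\omega_i\pi_{W_i}f\}_{i\in I}$; $S_W=T_WT_W^*$ is the (invertible) fusion frame operator; the excess is $e(W)=\dim N(T_W)$, where $N$ denotes the null space ($\infty$ if infinite dimensional). A fusion frame $V=\{(V_i,\upsilon_i)\}_{i\in I}$ of $\mathcal{H}$ is a $Q$-dual fusion frame of $W$ if there is a bounded operator $Q:\bigoplus_{i\in I}W_i\to\bigoplus_{i\in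 I}V_i$ with $T_VQT_W^*=I_{\mathcal{H}}$. The canonical dual of $W$ is $\widetilde{W}=\{(S_W^{-1}W_i,\omega_i)\}_{i\in I}$.
   Formalization: It is additionally assumed that some W_i is not H or that e(W) is infinite; if all W_i = H and e(W) is finite (e.g. I={1}, W_1=H), the canonical dual is the only fusion frame with these weights and this excess, so the claim fails. *)

(* Defs.v *)
From HB Require Import structures.
From mathcomp Require Import all_boot all_order all_algebra sesquilinear complex.
From mathcomp Require Import all_classical all_reals all_analysis.
From mathcomp Require summability.
Import Order.TTheory GRing.Theory Num.Theory.
Import numFieldNormedType.Exports.

Set Implicit Arguments.
Unset Strict Implicit.
Unset Printing Implicit Defensive.

Local Open Scope classical_set_scope.
Local Open Scope ring_scope.

(* Hilbert spaces are over the reals or over the complex numbers.  A Hilbert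
   space is a completeNormedModType H over [base_field R k] together with an inner
   product dot : {dot H for @base_conj R k} such that `|x| ^+ 2 = dot x x. *)
Variant base_kind := RealBase | ComplexBase.

Definition base_field (R : realType) (k : base_kind) : numFieldType :=
  match k with RealBase => R | ComplexBase => R[i] end.

Definition base_conj (R : realType) (k : base_kind) :
    base_field R k -> base_field R k :=
  match k with RealBase => id | ComplexBase => @conjc R end.

Definition base_re (R : realType) (k : base_kind) : base_field R k -> R :=
  match k with RealBase => id | ComplexBase => @complex.Re R end.

Definition of_real (R : realType) (k : base_kind) : R -> base_field R k :=
  match k with RealBase => id | ComplexBase => @real_complex R end.

Definition separable (T : topologicalType) :=
  exists2 D : set T, countable D & dense D.

Section dimension.
Context (R : realType) (k : base_kind) (X : lmodType (base_field R k)).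

Definition is_basis (E : set X) (n : nat) (b : 'I_n -> X) :=
  [/\ forall j, E (b j),
      forall c : 'I_n -> base_field R k,
        \sum_(j < n) c j *: b j = 0 -> forall j, c j = 0
    & forall x, E x ->
        exists c : 'I_n -> base_field R k, x = \sum_(j < n) c j *: b j].

(* Meant for linear subspaces E; +oo when E has no finite basis. *)
Definition dim (E : set X) : \bar R :=
  if pselect (exists n, exists b : 'I_n -> X, is_basis E b) is left ex
  then (projT1 (cid ex))%:R%:E else +oo%E.

End dimension.

Section fusion_frames.
Context (R : realType) (k : base_kind).
Context (H : completeNormedModType (base_field R k)).
Context (dot : {dot H for @base_conj R k}).
Context (I : countType).

(* `|x| lives in [base_field R k]; this is the same number, in R. *)
Definition rnorm (x : H) : R := base_re `|x|.

Definition closed_subspace (U : set H) :=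
  [/\ closed U, U 0 & forall a x y, U x -> U y -> U (a *: x + y)].

Definition proj (U : set H) (f : H) : H :=
  xget 0 [set g | U g /\ forall h, U h -> dot (f - g) h = 0].

Definition fusion_frame (W : I -> set H) (w : I -> R) :=
  [/\ forall i, closed_subspace (W i),
      forall i, 0 < w i
    & exists A B : R, [/\ 0 < A, A <= B & forall f : H,
        ((A * rnorm f ^+ 2)%:E
           <= \esum_(i in [set: I]) (w i ^+ 2 * rnorm (proj (W i) f) ^+ 2)%:E
           <= (B * rnorm f ^+ 2)%:E)%E]].

Definition sqnorm (c : I -> H) : \bar R :=
  \esum_(i in [set: I]) (rnorm (c i) ^+ 2)%:E.

Definition direct_sum (W : I -> set H) : set (I -> H) :=
  [set c | (forall i, W i (c i)) /\ (sqnorm c < +oo)%E].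

(* [summability.sum] is the unconditional sum (the limit of the partial sums
   along the finite subsets of I), which exists on [direct_sum W] when (W, w)
   is a fusion frame. *)
Definition synthesis (w : I -> R) (c : I -> H) : H :=
  summability.sum (fun i => of_real k (w i) *: c i).

Definition analysis (W : I -> set H) (w : I -> R) (f : H) : I -> H :=
  fun i => of_real k (w i) *: proj (W i) f.

Definition frame_operator (W : I -> set H) (w : I -> R) (f : H) : H :=
  synthesis w (analysis W w f).

Definition null_space (W : I -> set H) (w : I -> R) : set (I -> H) :=
  [set c | direct_sum W c /\ synthesis w c = 0].

Definition excess (W : I -> set H) (w : I -> R) : \bar R :=
  dim (null_space W w).

Definition bounded_operator (E F : set (I -> H)) (Q : (I -> H) -> (I -> H)) :=
  [/\ forall c, E c -> F (Q c),
      forall a c d, E c -> E d -> Q (a *: c + d) = a *: Q c + Q d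
    & exists C : R, forall c, E c ->
        (sqnorm (Q c) <= (C ^+ 2)%:E * sqnorm c)%E].

Definition Q_dual (W : I -> set H) (w : I -> R) (V : I -> set H) (v : I -> R) :=
  fusion_frame V v /\
  exists Q, bounded_operator (direct_sum W) (direct_sum V) Q /\
    forall f, synthesis v (Q (analysis W w f)) = f.

(* The frame operator of a fusion frame is a bijection of H, so this preimage
   is the image of W i under its inverse. *)
Definition canonical_dual (W : I -> set H) (w : I -> R) : I -> set H :=
  fun i => frame_operator W w @^-1` W i.

End fusion_frames.

(* Main.v *)
Require Import Defs.
From mathcomp Require Import all_boot all_order all_algebra sesquilinear complex.
From mathcomp Require Import all_classical all_reals all_analysis.
From mathcomp Require Import ring lra finmap.
From mathcomp Require summability.
Import Order.TTheory GRing.Theory Num.Theory.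
Import numFieldNormedType.Exports.

Set Implicit Arguments.
Unset Strict Implicit.
Unset Printing Implicit Defensive.

Local Open Scope classical_set_scope.
Local Open Scope ring_scope.

(** Any two fusion frames (W, w) and (V, v) of H indexed by the same set are
    Q-dual to each other: with T_W, T_V the synthesis operators and
    S_W = T_W T_W^*, S_V = T_V T_V^* the frame operators, the bounded operator
    Q = T_V^* S_V^-1 S_W^-1 T_W satisfies
      T_V Q T_W^* = S_V S_V^-1 S_W^-1 S_W = 1
    ([fusion_frames_Q_dual]).  Only the excess and the difference from the
    canonical dual have to be arranged.

    If W itself is not its canonical dual, V = W answers the question.
    Otherwise any fusion frame V <> W with the same weights and the same excess
    does, and there is always one ([exists_other_frame]):

    - If W i0 <> W i1 for some i0 and i1, exchange these two subspaces and keep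
      the weights.  If s is the transposition of i0 and i1, then
      c |-> ((w (s i) / w i) c (s i))_i is an isomorphism between the null
      spaces of the two synthesis operators, so the excess does not change.

    - If all the W i are one subspace U, the lower frame bound at a vector
      orthogonal to U forces U = H, so the non-degeneracy assumption says that
      the excess is infinite.  Take a nonzero c in the null space, i0 with
      u = c i0 <> 0, and replace the subspace of index i0 by the hyperplane
      orthogonal to u.  The null space of the new synthesis operator is the
      kernel of c |-> <c i0, u> in the old one; a hyperplane of an
      infinite-dimensional space is infinite-dimensional.

    The analytic foundation is one variational lemma, [energy_minimizer]: on a
    closed subspace, a bounded coercive symmetric form represents every bounded
    linear form.  Applied to the inner product it yields orthogonal projections;
    applied to <S_W x, y> it yields S_W^-1.  The real and the complex case are
    treated together by working, wherever inequalities are involved, with the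
    real part [rdot] of the inner product. *)

(** * Real scalars inside the base field *)

Section scalars.
Context (R : realType) (k : base_kind).
Local Notation K := (base_field R k).

Lemma base_reD (x y : K) : base_re (x + y) = base_re x + base_re y.
Proof. by case: k x y => // -[a b] [c d]. Qed.

Lemma base_reN (x : K) : base_re (- x) = - base_re x.
Proof. by case: k x => // -[a b]. Qed.

Lemma of_realD (r s : R) : of_real k (r + s) = of_real k r + of_real k s.
Proof. by case: k => //=; exact: rmorphD. Qed.

Lemma of_realM (r s : R) : of_real k (r * s) = of_real k r * of_real k s.
Proof. by case: k => //=; exact: rmorphM. Qed.

Lemma of_real1 : of_real k (1 : R) = 1.
Proof. by case: k. Qed.

Lemma of_realN (r : R) : of_real k (- r) = - of_real k r.
Proof. by case: k => //=; exact: rmorphN. Qed.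

Lemma of_real0 : of_real k (0 : R) = 0.
Proof. by case: k. Qed.

Lemma of_real_lt (r s : R) : (of_real k r < of_real k s) = (r < s).
Proof. by case: k => //=; exact: ltcR. Qed.

Lemma of_real_le (r s : R) : (of_real k r <= of_real k s) = (r <= s).
Proof. by case: k => //=; exact: lecR. Qed.

Lemma base_re_of_realM (r : R) (x : K) : base_re (of_real k r * x) = r * base_re x.
Proof. by case: k x => // -[a b] /=; rewrite mul0r subr0. Qed.

Lemma of_realK (r : R) : base_re (of_real k r) = r.
Proof. by case: k. Qed.

Lemma base_re_conj (x : K) : base_re (base_conj x) = base_re x.
Proof. by case: k x => // -[a b]. Qed.

(** With x = <g, h>, the product x * conj x is <g, x h>: on a subspace,
    orthogonality can therefore be tested on real parts. *)
Lemma base_re_mul_conj_eq0 (x : K) : base_re (x * base_conj x) = 0 -> x = 0.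
Proof.
case: k x => [x|[a b]] /=.
  by move/eqP; rewrite mulf_eq0 orbb => /eqP.
rewrite mulrN opprK => /eqP; rewrite -!expr2 paddr_eq0 ?sqr_ge0// !sqrf_eq0.
by move=> /andP[/eqP-> /eqP->].
Qed.

Lemma of_real_base_re (x : K) : 0 <= x -> of_real k (base_re x) = x.
Proof. by case: k x => // -[a b] /=; rewrite lecE /= => /andP[/eqP -> _]. Qed.

End scalars.

(** * The real inner product and convergence in norm *)

(** The discriminant of a nonnegative quadratic polynomial is nonpositive.  It
    yields the Cauchy-Schwarz inequality and, for energies, bounds how far an
    approximate minimizer is from satisfying the Euler equation. *)
Lemma quadratic_ge0_discr (R : realType) (p b q : R) : 0 <= q ->
  (forall t, 0 <= p + 2 * t * b + t ^+ 2 * q) -> b ^+ 2 <= p * q.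
Proof.
move=> q0 h; have [q_eq0|q_neq0] := eqVneq q 0.
  have [->|b_neq0] := eqVneq b 0; first by rewrite q_eq0 mulr0 expr0n.
  have := h (- (p + 1) / (2 * b)); rewrite q_eq0 mulr0 addr0.
  rewrite (_ : 2 * _ * b = - (p + 1)); first by lra.
  by field.
have q_gt0 : 0 < q by rewrite lt0r q_neq0.
have := h (- b / q).
rewrite (_ : p + _ + _ = (p * q - b ^+ 2) / q); last by field.
by rewrite pmulr_lge0 ?invr_gt0// subr_ge0.
Qed.

Lemma sqrrD_le (R : realType) (c d : R) : (c + d) ^+ 2 <= 2 * (c ^+ 2 + d ^+ 2).
Proof. by have := sqr_ge0 (c - d); rewrite sqrrB sqrrD; lra. Qed.

Lemma le0_of_le_sqr_mul (R : realType) (s c : R) : 0 <= c ->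
  (forall e, 0 < e -> s <= c * e ^+ 2) -> s <= 0.
Proof.
move=> c0 h; rewrite leNgt; apply/negP => s0.
have p0 : 0 < s / (2 * (c + 1)) by rewrite divr_gt0//; lra.
have := h _ (etrans (sqrtr_gt0 _) p0); rewrite sqr_sqrtr ?(ltW p0)//.
rewrite (_ : c * (s / _) = s * (c / (2 * (c + 1)))); last first.
  by field; lra.
apply/negP; rewrite -ltNge -[X in _ < X]mulr1 ltr_pM2l// ltr_pdivrMr; lra.
Qed.

Section inner_product.
Context (R : realType) (k : base_kind).
Local Notation K := (base_field R k).
Context (H : completeNormedModType K) (dot : {dot H for @base_conj R k}).
Context (norm_dot : forall x : H, `|x| ^+ 2 = dot x x).

Local Notation rn := (@rnorm R k H).

Definition rdot (x y : H) : R := base_re (dot x y).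

Lemma dotDl x y z : dot (x + y) z = dot x z + dot y z.
Proof. exact: linearDl. Qed.
Lemma dotZl a x z : dot (a *: x) z = a * dot x z.
Proof. exact: linearZl_LR. Qed.
Lemma dotNl x z : dot (- x) z = - dot x z.
Proof. exact: linearNl. Qed.
Lemma dotZr a x z : dot x (a *: z) = base_conj a * dot x z.
Proof. exact: linearZr_LR. Qed.
Lemma dotC x y : dot x y = base_conj (dot y x).
Proof. by rewrite (@hermitian_subproof _ _ _ _ dot) expr0 mul1r. Qed.

Lemma rdotC x y : rdot x y = rdot y x.
Proof. by rewrite /rdot dotC base_re_conj. Qed.
Lemma rdotDl x y z : rdot (x + y) z = rdot x z + rdot y z.
Proof. by rewrite /rdot dotDl base_reD. Qed.
Lemma rdotNl x z : rdot (- x) z = - rdot x z.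
Proof. by rewrite /rdot dotNl base_reN. Qed.
Lemma rdotBl x y z : rdot (x - y) z = rdot x z - rdot y z.
Proof. by rewrite rdotDl rdotNl. Qed.
Lemma rdotZl r x z : rdot (of_real k r *: x) z = r * rdot x z.
Proof. by rewrite /rdot dotZl base_re_of_realM. Qed.
Lemma rdotDr x y z : rdot z (x + y) = rdot z x + rdot z y.
Proof. by rewrite !(rdotC z) rdotDl. Qed.
Lemma rdotBr x y z : rdot z (x - y) = rdot z x - rdot z y.
Proof. by rewrite !(rdotC z) rdotBl. Qed.
Lemma rdotZr r x z : rdot z (of_real k r *: x) = r * rdot z x.
Proof. by rewrite !(rdotC z) rdotZl. Qed.
Lemma rdot0l z : rdot 0 z = 0.
Proof. by rewrite -(subrr 0) rdotBl subrr. Qed.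
Lemma rdot_suml (T : Type) (s : seq T) (f : T -> H) z :
  rdot (\sum_(i <- s) f i) z = \sum_(i <- s) rdot (f i) z.
Proof.
elim: s => [|i s IH]; first by rewrite !big_nil rdot0l.
by rewrite !big_cons rdotDl IH.
Qed.

Lemma normE (x : H) : `|x| = of_real k (rn x).
Proof. by rewrite of_real_base_re. Qed.

Lemma rnorm_sqr x : rn x ^+ 2 = rdot x x.
Proof. by rewrite /rdot -norm_dot normE [in RHS]expr2 -of_realM of_realK expr2. Qed.

Lemma rnorm_ge0 x : 0 <= rn x.
Proof. by rewrite -(of_real_le k) -normE of_real0. Qed.

Lemma rnorm_eq0 x : (rn x == 0) = (x == 0).
Proof.
by rewrite -[RHS]normr_eq0 normE -(inj_eq (can_inj (@of_realK R k))) of_real0.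
Qed.

Lemma rnorm0 : rn 0 = 0.
Proof. by apply/eqP; rewrite rnorm_eq0. Qed.

Lemma rnormN x : rn (- x) = rn x.
Proof. by rewrite /rnorm normrN. Qed.

Lemma rnorm_dist x y : rn (x - y) = rn (y - x).
Proof. by rewrite -rnormN opprB. Qed.

Lemma rnormD x y : rn (x + y) <= rn x + rn y.
Proof. by rewrite -(of_real_le k) of_realD -!normE ler_normD. Qed.

Lemma rnorm_sqrZ r x : rn (of_real k r *: x) ^+ 2 = r ^+ 2 * rn x ^+ 2.
Proof. by rewrite !rnorm_sqr rdotZl rdotZr; ring. Qed.

Lemma rdot_sqr_le x y : rdot x y ^+ 2 <= rn x ^+ 2 * rn y ^+ 2.
Proof.
rewrite rnorm_sqr; apply: quadratic_ge0_discr; first exact: sqr_ge0.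
move=> t; have := sqr_ge0 (rn (x + of_real k t *: y)).
rewrite !rnorm_sqr rdotDl !rdotDr !rdotZl !rdotZr (rdotC y x).
by congr (_ <= _); ring.
Qed.

Lemma rdot_le x y : rdot x y <= rn x * rn y.
Proof.
have [h|/ltW h] := leP (rdot x y) 0.
  by apply: le_trans h _; rewrite mulr_ge0 ?rnorm_ge0.
rewrite -(ler_pXn2r (n := 2)) ?nnegrE ?mulr_ge0 ?rnorm_ge0// exprMn.
exact: rdot_sqr_le.
Qed.

(** The metric of H takes its values in the base field; from here on convergence
    and completeness are expressed with real radii only. *)
Lemma cvg_rnormP (T : Type) (F : set_system T) {FF : Filter F} (u : T -> H) x :
  u @ F --> x <-> forall e : R, 0 < e -> \forall t \near F, rn (x - u t) < e.
Proof.
split=> [/cvgrPdist_lt ux e e0|ux].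
  have : 0 < of_real k e by rewrite -(of_real0 R k) of_real_lt.
  by move=> /ux; apply: filterS => t; rewrite normE of_real_lt.
apply/cvgrPdist_lt => e e0; have ee := of_real_base_re (ltW e0).
have : 0 < base_re e by rewrite -(of_real_lt k) of_real0 ee.
by move=> /ux; apply: filterS => t; rewrite normE -[X in _ -> _ < X]ee of_real_lt.
Qed.

Lemma cauchy_rnorm_cvg (T : Type) (F : set_system T) {FF : ProperFilter F}
    (u : T -> H) :
  (forall e : R, 0 < e -> exists x, \forall t \near F, rn (x - u t) < e) ->
  exists x : H, u @ F --> x.
Proof.
move=> cau; have : cvg (u @ F).
  apply: cauchy_cvg; apply: cauchy_exP => e e0.
  have ee := of_real_base_re (ltW e0).
  have : 0 < base_re e by rewrite -(of_real_lt k) of_real0 ee.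
  move=> /cau [x Fx]; exists x; apply: filterS Fx => t.
  by rewrite /= -ball_normE /= normE -[X in _ -> _ < X]ee of_real_lt.
by move=> /cvg_ex [x ux]; exists x.
Qed.

Lemma cvg_rdot (T : Type) (F : set_system T) {FF : Filter F} (u : T -> H) x y :
  u @ F --> x -> (fun t => rdot (u t) y) @ F --> rdot x y.
Proof.
move=> /cvg_rnormP ux; apply/cvgrPdist_lt => e e0.
have ny : 0 < rn y + 1 by have := rnorm_ge0 y; lra.
have /ux : 0 < e / (rn y + 1) by rewrite divr_gt0.
apply: filterS => t; rewrite -rdotBl ltr_pdivlMr// => h.
have n0 := rnorm_ge0 (x - u t).
have := rdot_sqr_le (x - u t) y; have := rnorm_ge0 y => y0 hs.
rewrite -(ltr_pXn2r (n := 2)) ?nnegrE ?normr_ge0 ?(ltW e0)//.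
rewrite real_normK ?num_real//; apply: le_lt_trans hs _.
rewrite -exprMn ltr_pXn2r ?nnegrE ?mulr_ge0 ?(ltW e0)//.
by apply: le_lt_trans h; rewrite ler_wpM2l// lerDl.
Qed.

End inner_product.

(** * Minimization of an energy on a closed subspace *)

Section energy.
Context (R : realType) (k : base_kind).
Local Notation K := (base_field R k).
Context (H : completeNormedModType K) (dot : {dot H for @base_conj R k}).
Context (norm_dot : forall x : H, `|x| ^+ 2 = dot x x).

Local Notation rn := (@rnorm R k H).
Local Notation "r *:: x" := (of_real k r *: x) (at level 40).
Context (a : H -> H -> R) (l : H -> R) (al M C : R) (U : set H).
Context (aC : forall x y, a x y = a y x).
Context (aD : forall x y z, a (x + y) z = a x z + a y z).
Context (aZ : forall r x z, a (r *:: x) z = r * a x z).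
Context (al_gt0 : 0 < al) (a_ge : forall x, al * rn x ^+ 2 <= a x x).
Context (a_le : forall x, a x x <= M * rn x ^+ 2).
Context (lD : forall x y, l (x + y) = l x + l y).
Context (lZ : forall r x, l (r *:: x) = r * l x).
Context (l_le : forall x, l x <= C * rn x).
Context (U0 : U 0) (UD : forall x y, U x -> U y -> U (x + y)).
Context (UZ : forall r x, U x -> U (r *:: x)) (U_closed : closed U).

Let J x := a x x - 2 * l x.

Let J_line x r y : J (x + r *:: y) = J x + 2 * r * (a x y - l y) + r ^+ 2 * a y y.
Proof.
rewrite /J aD aZ (aC x) (aC y (x + _)) !aD !aZ lD lZ (aC y x); ring.
Qed.

Let a_ge0 x : 0 <= a x x.
Proof. by apply: le_trans (a_ge x); rewrite mulr_ge0 ?(ltW al_gt0) ?sqr_ge0. Qed.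

Let a_CS z y : a z y ^+ 2 <= a z z * a y y.
Proof.
apply: quadratic_ge0_discr => // t; have := a_ge0 (z + t *:: y).
rewrite aD aZ (aC _ (_ + _)) (aC y (_ + _)) !aD !aZ (aC y).
by congr (_ <= _); ring.
Qed.

Let J_lb x : - (C ^+ 2 / al) <= J x.
Proof.
rewrite /J; have := a_ge x; have := l_le x.
suff : 2 * (C * rn x) <= al * rn x ^+ 2 + C ^+ 2 / al by lra.
rewrite -subr_ge0 (_ : _ - _ = (al * rn x - C) ^+ 2 / al); last first.
  by field; rewrite gt_eqF.
by rewrite divr_ge0 ?sqr_ge0// ltW.
Qed.

Let JU := [set J x | x in U].
Let m := inf JU.

Let has_inf_JU : has_inf JU.
Proof.
split; first by exists (J 0); exists 0.
by exists (- (C ^+ 2 / al)) => _ [x _ <-].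
Qed.

Let m_le x : U x -> m <= J x.
Proof. by move=> Ux; apply: ge_inf; [exact: has_inf_JU.2|exists x]. Qed.

(** The minimizer of J x = a x x - 2 l x on U satisfies the Euler equation
    a x y = l y.  A minimizing sequence is Cauchy because the parallelogram
    identity bounds a d d, for d the difference of two terms, by what the values
    of J at these terms leave above its infimum m. *)
Lemma energy_minimizer : exists x, U x /\ forall y, U y -> a x y = l y.
Proof.
have /choice[u uP] : forall n : nat, exists x, U x /\ J x < m + n.+1%:R^-1.
  move=> n.
  have e0 : 0 < n.+1%:R^-1 :> R by rewrite invr_gt0.
  by have [_ [x Ux <-] ?] := inf_adherent e0 has_inf_JU; exists x.
have UB x y : U x -> U y -> U (y - x).
  move=> Ux Uy; apply: UD => //.
  by rewrite -scaleN1r -(of_real1 R k) -of_realN; exact: UZ.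
have dist p q : al * rn (u p - u q) ^+ 2 <= 2 * (p.+1%:R^-1 + q.+1%:R^-1).
  have [Up Jp] := uP p; have [Uq Jq] := uP q.
  set d := u q - u p; have Ud : U d by exact: UB.
  rewrite rnorm_dist -/d; apply: le_trans (a_ge d) _.
  (* compare J with its infimum at the midpoint of u p and u q *)
  have hm := m_le (UD Up (UZ 2^-1 Ud)).
  have := J_line (u p) 2^-1 d; have := J_line (u p) 1 d.
  rewrite of_real1 scale1r {1}/d [u p + _]addrC subrK => J1 J2.
  move: hm Jp Jq; rewrite J2 J1.
  move: (J (u p)) (a (u p) d - l d) (a d d) p.+1%:R^-1 q.+1%:R^-1 => Jp D A s t.
  lra.
have [x ux] : exists x : H, u @ \oo --> x.
  apply: cauchy_rnorm_cvg => e e0.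
  have e'0 : 0 < al * e ^+ 2 / 4 by rewrite divr_gt0// mulr_gt0// exprn_gt0.
  have [N _ NP] := near_infty_natSinv_lt (PosNum e'0).
  exists (u N); exists N => // q /= Nq.
  rewrite -(ltr_pXn2r (n := 2)) ?nnegrE ?rnorm_ge0 ?(ltW e0)//.
  rewrite -(ltr_pM2l al_gt0); apply: le_lt_trans (dist _ _) _.
  have hN : N.+1%:R^-1 < al * e ^+ 2 / 4 := NP N (leqnn N).
  have hq : q.+1%:R^-1 < al * e ^+ 2 / 4 := NP q Nq.
  by move: hN hq; set s := N.+1%:R^-1; set t := q.+1%:R^-1; lra.
exists x; split.
  by apply: closed_cvg ux => //; apply: nearW => n; exact: (uP n).1.
move=> y Uy; apply/eqP; rewrite -subr_eq0 -sqrf_eq0 eq_le sqr_ge0 andbT.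
apply: (@le0_of_le_sqr_mul _ _ (2 * a y y * (`|M| + 1))) => [|e e0].
  by rewrite !mulr_ge0// addr_ge0.
have e20 : 0 < e ^+ 2 by rewrite exprn_gt0.
have /cvg_rnormP/(_ _ e0) near1 := ux.
near \oo => n.
have xn : rn (x - u n) < e by near: n.
have en : n.+1%:R^-1 < e ^+ 2 by near: n; exact: (near_infty_natSinv_lt (PosNum e20)).
have [Un Jn] := uP n.
(* d is the defect of u n in the Euler equation, c the error made by
   replacing u n by its limit; both are small *)
pose d := a (u n) y - l y.
have hd : d ^+ 2 <= n.+1%:R^-1 * a y y.
  apply: quadratic_ge0_discr => // t.
  have := m_le (UD Un (UZ t Uy)); rewrite J_line -/d; move: Jn.
  by move: (J (u n)) d (a y y) n.+1%:R^-1 => Jn D A s; lra.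
pose c := a (x - u n) y.
have hc : c ^+ 2 <= a (x - u n) (x - u n) * a y y by exact: a_CS.
have -> : a x y - l y = c + d.
  by rewrite /c /d addrA -aD subrK.
have hM : a (x - u n) (x - u n) <= `|M| * e ^+ 2.
  apply: le_trans (a_le _) _.
  apply: (@le_trans _ _ (`|M| * rn (x - u n) ^+ 2)).
    by rewrite ler_wpM2r ?sqr_ge0// ler_norm.
  by rewrite ler_wpM2l// lerXn2r ?nnegrE ?rnorm_ge0 ?(ltW e0) ?(ltW xn).
have hcd : (c + d) ^+ 2 <= 2 * (c ^+ 2 + d ^+ 2) by exact: sqrrD_le.
apply: le_trans hcd _; have := a_ge0 y => ay.
have := ler_wpM2r ay hM; have := ler_wpM2r ay (ltW en).
move: hc hd; move: (c ^+ 2) (d ^+ 2) (a (x - u n) (x - u n)) n.+1%:R^-1 => c2 d2 q s.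
by move=> h1 h2 h3 h4; lra.
Unshelve. all: by end_near.
Qed.

End energy.

(** * Orthogonal projections *)

Section projection.
Context (R : realType) (k : base_kind).
Local Notation K := (base_field R k).
Context (H : completeNormedModType K) (dot : {dot H for @base_conj R k}).
Context (norm_dot : forall x : H, `|x| ^+ 2 = dot x x).
Local Notation rn := (@rnorm R k H).
Context (U : set H) (U_sub : closed_subspace U).

Lemma subspaceD x y : U x -> U y -> U (x + y).
Proof. by case: U_sub => _ _ UP Ux Uy; rewrite -(scale1r x); exact: UP. Qed.

Lemma subspaceZ a x : U x -> U (a *: x).
Proof. by case: U_sub => _ U0 UP Ux; rewrite -(addr0 (_ *: _)); exact: UP. Qed.

Lemma subspaceB x y : U x -> U y -> U (x - y).
Proof. by move=> Ux Uy; apply: subspaceD => //; rewrite -scaleN1r; exact: subspaceZ. Qed.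

(** The projection of f is the minimizer on U of |x|^2 - 2 Re <f, x>, whose
    Euler equation is the orthogonality of f - x to U. *)
Lemma proj_spec f :
  U (Defs.proj dot U f) /\ forall h, U h -> dot (f - Defs.proj dot U f) h = 0.
Proof.
suff : exists g, [set g | U g /\ forall h, U h -> dot (f - g) h = 0] g.
  by move=> /(@xgetPex H 0).
have [cU U0 UP] := U_sub.
have [] := @energy_minimizer R k H (rdot dot) (rdot dot f) 1 1 (rn f) U => //.
- exact: rdotC.
- exact: rdotDl.
- exact: rdotZl.
- by move=> x; rewrite mul1r (rnorm_sqr norm_dot).
- by move=> x; rewrite mul1r (rnorm_sqr norm_dot).
- by move=> x y; exact: rdotDr.
- by move=> r x; exact: rdotZr.
- by move=> x; exact: rdot_le.
- by move=> x y; exact: subspaceD.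
- by move=> r x; exact: subspaceZ.
move=> x [Ux xP]; exists x; split => // h Uh.
(* the Euler equation at the vector <f - x, h> h *)
apply: base_re_mul_conj_eq0; rewrite mulrC -dotZr.
by apply/eqP; rewrite -/(rdot _ _ _) rdotBl xP ?subrr//; exact: subspaceZ.
Qed.

Lemma proj_in f : U (Defs.proj dot U f).
Proof. by have [] := proj_spec f. Qed.

Lemma proj_unique f g : U g -> (forall h, U h -> dot (f - g) h = 0) ->
  Defs.proj dot U f = g.
Proof.
move=> Ug gP; have [Up pP] := proj_spec f.
have Ud : U (Defs.proj dot U f - g) by exact: subspaceB.
apply/eqP; rewrite -subr_eq0 -(@rnorm_eq0 R k) -sqrf_eq0 (rnorm_sqr norm_dot).
rewrite -[X in rdot _ X _](_ : (f - g) - (f - Defs.proj dot U f) = _).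
  by rewrite rdotBl /rdot gP// pP// subrr.
by rewrite opprB addrC addrA subrK.
Qed.

Lemma proj_linear a x y :
  Defs.proj dot U (a *: x + y) = a *: Defs.proj dot U x + Defs.proj dot U y.
Proof.
have [Ux xP] := proj_spec x; have [Uy yP] := proj_spec y.
apply: proj_unique; first by apply: subspaceD => //; exact: subspaceZ.
move=> h Uh; rewrite opprD addrACA -scalerBr dotDl dotZl xP// yP//.
by rewrite mulr0 addr0.
Qed.

Lemma rdot_proj h f : U h -> rdot dot h (Defs.proj dot U f) = rdot dot h f.
Proof.
move=> Uh; apply/eqP; rewrite eq_sym -subr_eq0 -rdotBr rdotC /rdot.
by rewrite (proj_spec f).2// -(of_real0 R k) of_realK.
Qed.

Lemma proj_le f : rn (Defs.proj dot U f) <= rn f.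
Proof.
have [->|p0] := eqVneq (rn (Defs.proj dot U f)) 0; first exact: rnorm_ge0.
have p_gt0 : 0 < rn (Defs.proj dot U f) by rewrite lt0r p0 rnorm_ge0.
rewrite -(ler_pM2l p_gt0) -expr2 (rnorm_sqr norm_dot).
by rewrite (rdot_proj f (proj_in f)) rdot_le.
Qed.

End projection.

(** * Sums over finite subsets *)

Section esum_fset.
Context (R : realType) (I : choiceType) (a : I -> R).
Context (a_ge0 : forall i, 0 <= a i).

Lemma fset_sum_le_esum (F : {fset I}) :
  ((\sum_(i <- F) a i)%:E <= \esum_(i in [set: I]) (a i)%:E)%E.
Proof.
apply: esum_ge; exists [set` F]; first by split.
by rewrite fsbig_finite//= set_fsetK sumEFin.
Qed.

Lemma esum_le_fset (M : R) : (forall F : {fset I}, \sum_(i <- F) a i <= M) ->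
  (\esum_(i in [set: I]) (a i)%:E <= M%:E)%E.
Proof.
move=> aM; apply: ge_ereal_sup => _ [X [finX _] <-].
by rewrite fsbig_finite// sumEFin lee_fin; exact: aM.
Qed.

Lemma sum_fsetD (V : zmodType) (f : I -> V) (A B : {fset I}) : (A `<=` B)%fset ->
  \sum_(i <- B) f i = \sum_(i <- A) f i + \sum_(i <- (B `\` A)%fset) f i.
Proof.
move=> AB; rewrite (big_fsetID _ (mem A)) /=; congr (_ + _).
  apply: eq_fbigl => i; rewrite !inE /=.
  by case: (boolP (i \in A)) => [/(fsubsetP AB)->//|]; rewrite andbF.
by apply: eq_fbigl => i; rewrite !inE /= andbC.
Qed.

Lemma esum_tail e : 0 < e -> (\esum_(i in [set: I]) (a i)%:E < +oo)%E ->
  exists A : {fset I}, forall B : {fset I}, (A `<=` B)%fset ->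
    \sum_(i <- (B `\` A)%fset) a i < e.
Proof.
move=> e0 afin; set s := esum _ _ in afin.
have s_fin : s \is a fin_num.
  by rewrite ge0_fin_numE// esum_ge0// => i _; rewrite lee_fin.
have [_ [X [finX _] <-]] := ub_ereal_sup_adherent e0 s_fin.
rewrite -/s fsbig_finite// sumEFin => Xs; exists (fset_set X) => B XB.
have := fset_sum_le_esum B; rewrite -/s (sum_fsetD _ XB).
rewrite -(fineK s_fin) lee_fin => h.
by move: Xs; rewrite -[X in (X - _)%E](fineK s_fin) -EFinB lte_fin; lra.
Qed.

End esum_fset.

#[local] Existing Instance summability.totally_filter.

Section unconditional_sum.
Context (R : realType) (k : base_kind).
Local Notation K := (base_field R k).
Context (H : completeNormedModType K) (I : choiceType).

Definition has_sum (x : I -> H) (s : H) :=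
  (fun F : {fset I} => \sum_(i <- F) x i) @ summability.totally --> s.

Lemma partial_sumE (x : I -> H) :
  summability.partial_sum x = fun F : {fset I} => \sum_(i <- F) x i.
Proof. by apply/funext => F; rewrite /summability.partial_sum big_seq_fsetE. Qed.

Lemma sumE (x : I -> H) s : has_sum x s -> summability.sum x = s.
Proof.
by move=> xs; rewrite /summability.sum partial_sumE; apply: cvg_lim => //;
  exact: norm_hausdorff.
Qed.

Lemma has_sum_linear a (x y : I -> H) s t : has_sum x s -> has_sum y t ->
  has_sum (fun i => a *: x i + y i) (a *: s + t).
Proof.
move=> xs yt; rewrite /has_sum.
under eq_fun do rewrite big_split -scaler_sumr.
by apply: cvgD => //; exact: cvgZl_tmp.
Qed.

Lemma has_sum_finite (A : {fset I}) (x : I -> H) :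
  (forall i, i \notin A -> x i = 0) -> has_sum x (\sum_(i <- A) x i).
Proof.
move=> x0; apply: cvg_near_cst; exists A => // B /= AB.
by apply/esym/big_fset_incl => // i _; exact: x0.
Qed.

End unconditional_sum.

(** * Synthesis, analysis and the frame operator *)

Section frame.
Context (R : realType) (k : base_kind).
Local Notation K := (base_field R k).
Context (H : completeNormedModType K) (dot : {dot H for @base_conj R k}).
Context (norm_dot : forall x : H, `|x| ^+ 2 = dot x x).
Context (I : countType).
Local Notation rn := (@rnorm R k H).
Implicit Types (W : I -> set H) (w : I -> R) (c d : I -> H).

(** The frame condition bounds a sum over all of I; testing it on the finite
    partial sums keeps all the inequalities between real numbers. *)
Definition frame_sum W w (F : {fset I}) (f : H) : R :=
  \sum_(i <- F) w i ^+ 2 * rn (Defs.proj dot (W i) f) ^+ 2.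

Lemma fusion_frameP W w :
  fusion_frame dot W w <->
  [/\ forall i, closed_subspace (W i), forall i, 0 < w i
    & exists A B : R, [/\ 0 < A, 0 < B,
        forall f F, frame_sum W w F f <= B * rn f ^+ 2
      & forall f M, (forall F, frame_sum W w F f <= M) -> A * rn f ^+ 2 <= M]].
Proof.
have term_ge0 f i : 0 <= w i ^+ 2 * rn (Defs.proj dot (W i) f) ^+ 2.
  by rewrite mulr_ge0 ?sqr_ge0.
split=> -[Wsub w_gt0 [A [B []]]] => [A0 AB ABf|A0 B0 fB fA]; split => //.
  exists A, B; split => //; first exact: lt_le_trans AB.
    move=> f F; have /andP[_] := ABf f; rewrite -lee_fin.
    by apply: le_trans; exact: fset_sum_le_esum.
  move=> f M fM; have /andP[+ _] := ABf f; rewrite -lee_fin => /le_trans; apply.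
  exact: esum_le_fset.
exists A, (A + B); split => // [|f]; first by rewrite lerDl ltW.
have fsum_le : (\esum_(i in [set: I])
    (w i ^+ 2 * rn (Defs.proj dot (W i) f) ^+ 2)%:E <= (B * rn f ^+ 2)%:E)%E.
  by apply: esum_le_fset => F; exact: fB.
apply/andP; split; last first.
  apply: le_trans fsum_le _; rewrite lee_fin ler_wpM2r ?sqr_ge0//.
  by rewrite lerDr ltW.
have e_fin : (\esum_(i in [set: I])
    (w i ^+ 2 * rn (Defs.proj dot (W i) f) ^+ 2)%:E)%E \is a fin_num.
  rewrite ge0_fin_numE ?(le_lt_trans fsum_le) ?ltry// esum_ge0// => i _.
  by rewrite lee_fin.
rewrite -(fineK e_fin) lee_fin; apply: fA => F.
by rewrite -lee_fin fineK//; exact: fset_sum_le_esum.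
Qed.

Lemma sqnorm_fin_num c : (sqnorm c < +oo)%E -> sqnorm c \is a fin_num.
Proof.
move=> c_fin; rewrite ge0_fin_numE// esum_ge0// => i _.
by rewrite lee_fin sqr_ge0.
Qed.

Section fixed_frame.
Context (W : I -> set H) (w : I -> R) (A B : R).
Context (W_sub : forall i, closed_subspace (W i)).
Context (A_gt0 : 0 < A) (B_gt0 : 0 < B).
Context (frame_le : forall f F, frame_sum W w F f <= B * rn f ^+ 2).
Context (frame_ge : forall f M,
  (forall F, frame_sum W w F f <= M) -> A * rn f ^+ 2 <= M).

Local Notation "w *:: c" := (fun i => of_real k (w i) *: c i) (at level 40).
Local Notation P i := (Defs.proj dot (W i)).

(** Bessel bound for the synthesis operator.  Since <c i, x> = <c i, P i x> for
    c i in W i, the vector x = \sum_(i <- F) w i c i satisfies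
      2 B |x|^2 = \sum_(i <- F) 2 B w i Re <c i, P i x>
               <= \sum_(i <- F) (B^2 |c i|^2 + w i^2 |P i x|^2),
    and the last terms add up to at most B |x|^2. *)
Lemma partial_synthesis_le c (F : {fset I}) : (forall i, W i (c i)) ->
  rn (\sum_(i <- F) (w *:: c) i) ^+ 2 <= B * \sum_(i <- F) rn (c i) ^+ 2.
Proof.
move=> cW; set x := \sum_(i <- F) _.
have term i : 2 * B * rdot dot ((w *:: c) i) x <=
    B ^+ 2 * rn (c i) ^+ 2 + w i ^+ 2 * rn (P i x) ^+ 2.
  rewrite rdotZl -(rdot_proj norm_dot (W_sub i) x (cW i)).
  have := sqr_ge0 (rn (of_real k B *: c i - of_real k (w i) *: P i x)).
  rewrite !(rnorm_sqr norm_dot) rdotBl !rdotBr !rdotZl !rdotZr.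
  rewrite (rdotC dot (P i x) (c i)) -!(rnorm_sqr norm_dot).
  by rewrite -subr_ge0 => h; rewrite -subr_ge0; apply: le_trans h _; lra.
have : 2 * B * rn x ^+ 2 <=
    B ^+ 2 * \sum_(i <- F) rn (c i) ^+ 2 + frame_sum W w F x.
  rewrite (rnorm_sqr norm_dot) {1}/x rdot_suml !mulr_sumr -big_split /=.
  by apply: ler_sum => i _; exact: term.
move=> /le_trans /(_ (lerD (lexx _) (frame_le x F))) h.
by rewrite -(ler_pM2l B_gt0) [leRHS]mulrA -expr2; lra.
Qed.

Lemma sqnorm_psum_le c M : (sqnorm c <= M%:E)%E ->
  forall F : {fset I}, \sum_(i <- F) rn (c i) ^+ 2 <= M.
Proof.
move=> cM F; rewrite -lee_fin; apply: le_trans cM.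
by apply: fset_sum_le_esum => i; exact: sqr_ge0.
Qed.

(** The Bessel bound on the tails of c makes the net of partial sums Cauchy. *)
Lemma synthesis_has_sum c : direct_sum W c -> has_sum (w *:: c) (synthesis w c).
Proof.
move=> [cW c_fin]; suff [s cs] : exists s, has_sum (w *:: c) s.
  by rewrite /synthesis (sumE cs).
apply: cauchy_rnorm_cvg => e e0.
have e'0 : 0 < e ^+ 2 / B by rewrite divr_gt0 ?exprn_gt0.
have [||F FP] := @esum_tail R I (fun i => rn (c i) ^+ 2) _ _ e'0 => //.
  by move=> i; exact: sqr_ge0.
exists (\sum_(i <- F) (w *:: c) i); exists F => // G /= FG.
rewrite (sum_fsetD _ FG) opprD addrA subrr add0r rnormN.
rewrite -(ltr_pXn2r (n := 2)) ?nnegrE ?rnorm_ge0 ?(ltW e0)//.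
apply: le_lt_trans (partial_synthesis_le _ cW) _.
by rewrite mulrC -ltr_pdivlMr//; exact: FP.
Qed.

(** The bound on the partial sums x passes to their limit s through
    2 Re <x, s> <= |x|^2 + |s|^2 <= B M + |s|^2, whose left-hand side tends to
    2 |s|^2. *)
Lemma synthesis_le c M : direct_sum W c -> (sqnorm c <= M%:E)%E ->
  rn (synthesis w c) ^+ 2 <= B * M.
Proof.
move=> cW cM; have := synthesis_has_sum cW; set s := synthesis w c => cs.
have : rdot dot s s <= (B * M + rn s ^+ 2) / 2.
  apply: cvgr_to_le (cvg_rdot norm_dot (y := s) cs) _; apply: nearW => F.
  set x := \sum_(i <- F) _.
  have := sqr_ge0 (rn (x - s)).
  rewrite !(rnorm_sqr norm_dot) rdotBl !rdotBr (rdotC dot s x) -!(rnorm_sqr norm_dot).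
  have : rn x ^+ 2 <= B * M.
    apply: le_trans (partial_synthesis_le _ cW.1) _.
    by rewrite ler_pM2l//; exact: sqnorm_psum_le.
  by lra.
by rewrite -(rnorm_sqr norm_dot); lra.
Qed.

Lemma direct_sum_linear a c d : direct_sum W c -> direct_sum W d ->
  direct_sum W (a *: c + d).
Proof.
move=> [cW c_fin] [dW d_fin]; split=> [i|].
  by apply: subspaceD => //; exact: subspaceZ.
have fine_le e : (sqnorm e < +oo)%E -> forall F : {fset I},
    \sum_(i <- F) rn (e i) ^+ 2 <= fine (sqnorm e).
  by move=> e_fin; apply: sqnorm_psum_le; rewrite fineK// sqnorm_fin_num.
have aE : `|a| = of_real k (base_re `|a|) by rewrite of_real_base_re.
set C := 2 * (base_re `|a| ^+ 2 * fine (sqnorm c) + fine (sqnorm d)).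
apply: (@le_lt_trans _ _ C%:E); last exact: ltry.
apply: esum_le_fset => F.
apply: (@le_trans _ _ (\sum_(i <- F)
   2 * (base_re `|a| ^+ 2 * rn (c i) ^+ 2 + rn (d i) ^+ 2))).
  apply: ler_sum => i _; apply: (@le_trans _ _ ((rn (a *: c i) + rn (d i)) ^+ 2)).
    by rewrite lerXn2r ?nnegrE ?addr_ge0 ?rnorm_ge0// rnormD.
  apply: le_trans (sqrrD_le _ _) _.
  by rewrite {1}/rnorm normrZ aE base_re_of_realM of_realK exprMn.
rewrite -mulr_sumr ler_pM2l// big_split -mulr_sumr /=.
by apply: lerD; [apply: ler_wpM2l; [exact: sqr_ge0|]|]; exact: fine_le.
Qed.

Lemma synthesis_linear a c d : direct_sum W c -> direct_sum W d ->
  synthesis w (a *: c + d) = a *: synthesis w c + synthesis w d.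
Proof.
move=> cW dW; rewrite {1}/synthesis.
apply: sumE; rewrite (_ : (fun i => _) = fun i => a *: (w *:: c) i + (w *:: d) i).
  by apply: has_sum_linear; exact: synthesis_has_sum.
by apply/funext => i; rewrite scalerDr !scalerA mulrC.
Qed.

Lemma analysis_sqnorm_le f : (sqnorm (analysis dot W w f) <= (B * rn f ^+ 2)%:E)%E.
Proof.
apply: esum_le_fset => F; apply: le_trans (frame_le f F).
by apply: ler_sum => i _; rewrite (rnorm_sqrZ norm_dot).
Qed.

Lemma analysis_direct_sum f : direct_sum W (analysis dot W w f).
Proof.
split=> [i|]; first by apply: subspaceZ => //; exact: proj_in.
by apply: le_lt_trans (analysis_sqnorm_le f) _; exact: ltry.
Qed.

Lemma analysis_linear a f g :
  analysis dot W w (a *: f + g) = a *: analysis dot W w f + analysis dot W w g.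
Proof.
apply/funext => i; rewrite /analysis (proj_linear norm_dot (W_sub i)) scalerDr.
by rewrite scalerA mulrC -scalerA.
Qed.

Local Notation S := (frame_operator dot W w).

Lemma frame_operator_linear a f g : S (a *: f + g) = a *: S f + S g.
Proof.
by rewrite /frame_operator analysis_linear synthesis_linear//;
  exact: analysis_direct_sum.
Qed.

(** Both the symmetry of the frame operator and the fact that <S f, f> is the
    sum in the frame condition can be read off this limit. *)
Lemma cvg_rdot_frame_operator f g :
  (fun F : {fset I} => \sum_(i <- F) w i ^+ 2 * rdot dot (P i f) (P i g))
    @ summability.totally --> rdot dot (S f) g.
Proof.
rewrite (_ : (fun F => _) = fun F : {fset I} =>
    rdot dot (\sum_(i <- F) (w *:: analysis dot W w f) i) g).
  exact: cvg_rdot (synthesis_has_sum (analysis_direct_sum f)).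
apply/funext => F; rewrite rdot_suml; apply: eq_bigr => i _; apply/esym.
rewrite !rdotZl mulrA -expr2 (rdot_proj norm_dot (W_sub i))//.
exact: proj_in.
Qed.

Lemma frame_operator_sym f g : rdot dot (S f) g = rdot dot (S g) f.
Proof.
apply: (cvg_unique _ (@cvg_rdot_frame_operator f g)) => //=.
rewrite (_ : (fun F => _) = fun F : {fset I} =>
    \sum_(i <- F) w i ^+ 2 * rdot dot (P i g) (P i f)).
  exact: cvg_rdot_frame_operator.
by apply/funext => F; apply: eq_bigr => i _; rewrite rdotC.
Qed.

Lemma frame_operator_le f : rdot dot (S f) f <= B * rn f ^+ 2.
Proof.
apply: cvgr_to_le (@cvg_rdot_frame_operator f f) _; apply: nearW => F.
apply: le_trans (frame_le f F); apply: ler_sum => i _.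
by rewrite (rnorm_sqr norm_dot).
Qed.

Lemma frame_operator_ge f : A * rn f ^+ 2 <= rdot dot (S f) f.
Proof.
apply: frame_ge => F; apply: cvgr_to_ge (@cvg_rdot_frame_operator f f) _.
exists F => // G /= FG; rewrite (sum_fsetD _ FG).
rewrite /frame_sum; under eq_bigr do rewrite (rnorm_sqr norm_dot).
rewrite lerDl sumr_ge0// => i _.
by rewrite mulr_ge0 ?sqr_ge0// -(rnorm_sqr norm_dot) sqr_ge0.
Qed.

(** Surjectivity comes from minimizing <S x, x> - 2 Re <h, x> on the whole space,
    where S is coercive by the lower frame bound; that bound also gives
    A |f| <= |S f|, hence injectivity and the norm of the inverse. *)
Lemma frame_operator_inverse : exists T : H -> H,
  [/\ forall h, S (T h) = h, forall f, T (S f) = f,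
      forall a f g, T (a *: f + g) = a *: T f + T g
    & forall h, rn (T h) <= A^-1 * rn h].
Proof.
have S_add x y : S (x + y) = S x + S y.
  by have := frame_operator_linear 1 x y; rewrite !scale1r.
have S_scale a x : S (a *: x) = a *: S x.
  have S0 : S 0 = 0 by apply: (addIr (S 0)); rewrite -S_add !add0r.
  by have := frame_operator_linear a x 0; rewrite S0 !addr0.
have S_ge f : A * rn f <= rn (S f).
  have [->|nf] := eqVneq (rn f) 0; first by rewrite mulr0 rnorm_ge0.
  have nf0 : 0 < rn f by rewrite lt0r nf rnorm_ge0.
  rewrite -(ler_pM2r nf0) -mulrA -expr2.
  exact: le_trans (frame_operator_ge f) (rdot_le norm_dot _ _).
have S_inj : injective S.
  move=> f g fg; apply/eqP; rewrite -subr_eq0 -(@rnorm_eq0 R k) eq_le rnorm_ge0.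
  rewrite andbT -(ler_pM2l A_gt0) mulr0; apply: le_trans (S_ge _) _.
  by rewrite -scaleN1r S_add S_scale fg scaleN1r subrr rnorm0.
have /choice[T ST] h : exists x, S x = h.
  have [] := @energy_minimizer R k H (fun x => rdot dot (S x)) (rdot dot h)
    A B (rn h) [set: H] => //.
  - exact: frame_operator_sym.
  - by move=> x y z; rewrite S_add rdotDl.
  - by move=> r x z; rewrite S_scale rdotZl.
  - exact: frame_operator_ge.
  - exact: frame_operator_le.
  - by move=> x y; exact: rdotDr.
  - by move=> r x; exact: rdotZr.
  - by move=> x; exact: rdot_le.
  move=> x [_ xh]; exists x; apply/eqP; rewrite -subr_eq0.
  rewrite -(@rnorm_eq0 R k) -sqrf_eq0 (rnorm_sqr norm_dot) rdotBl.
  by rewrite xh// subrr.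
exists T; split => // [f|a f g|h].
- exact: S_inj.
- by apply: S_inj; rewrite frame_operator_linear !ST.
- by rewrite ler_pdivlMl// -[in leRHS](ST h) S_ge.
Qed.

End fixed_frame.

End frame.

(** * Dimension *)

Section dimension.
Context (R : realType) (k : base_kind) (X : lmodType (base_field R k)).
Local Notation K := (base_field R k).
Implicit Types E : set X.

(** The coordinates of a basis b in a basis b' form a matrix without left kernel,
    which cannot have more rows than columns. *)
Lemma basis_card_le E n m (b : 'I_n -> X) (b' : 'I_m -> X) :
  is_basis E b -> is_basis E b' -> (n <= m)%N.
Proof.
move=> [bE b_free _] [_ _ b'_gen].
have /choice[M bM] : forall j, exists c : 'I_m -> K, b j = \sum_(i < m) c i *: b' i.
  by move=> j; exact: b'_gen.
pose coords := \matrix_(j < n, i < m) M j i.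
suff : row_free coords by move=> /eqP <-; exact: rank_leq_col.
apply: inj_row_free => v vM; apply/rowP => j; rewrite mxE.
apply: (b_free (v 0)).
under eq_bigr => i _ do rewrite bM scaler_sumr.
rewrite exchange_big big1// => i _; under eq_bigr do rewrite scalerA.
rewrite -scaler_suml (_ : \sum_(j' < n) _ = (v *m coords) 0 i).
  by rewrite vM mxE scale0r.
by rewrite mxE; apply: eq_bigr => j' _; rewrite mxE.
Qed.

Lemma dim_basis E n (b : 'I_n -> X) : is_basis E b -> Defs.dim E = n%:R%:E.
Proof.
move=> bE; rewrite /Defs.dim; case: pselect => [ex|]; last by case; exists n, b.
have [b' b'E] := projT2 (cid ex).
congr (_%:R%:E); apply/eqP.
by rewrite eqn_leq !(basis_card_le bE b'E, basis_card_le b'E bE).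
Qed.

Lemma dim_pinftyP E : Defs.dim E = +oo%E <-> forall n (b : 'I_n -> X), ~ is_basis E b.
Proof.
split=> [Eoo n b bE|noE]; first by have := dim_basis bE; rewrite Eoo.
by rewrite /Defs.dim; case: pselect => // ex; case: (ex) => n [b bE]; have := noE _ _ bE.
Qed.

Lemma linear_zero (Y : lmodType K) (f : X -> Y) :
  (forall a x y, f (a *: x + y) = a *: f x + f y) -> f 0 = 0.
Proof.
move=> f_lin; have := f_lin 1 0 0.
by rewrite !scale1r addr0 -[LHS]addr0 => /addrI.
Qed.

Lemma linear_comb (Y : lmodType K) (f : X -> Y) :
  (forall a x y, f (a *: x + y) = a *: f x + f y) ->
  forall n (c : 'I_n -> K) (b : 'I_n -> X),
    f (\sum_(j < n) c j *: b j) = \sum_(j < n) c j *: f (b j).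
Proof.
move=> f_lin; elim=> [|n IH] c b; first by rewrite !big_ord0 linear_zero.
by rewrite !big_ord_recl f_lin IH.
Qed.

Lemma dim_involution E E' (f : X -> X) : involutive f ->
  (forall a x y, f (a *: x + y) = a *: f x + f y) ->
  (forall x, E x -> E' (f x)) -> (forall x, E' x -> E (f x)) -> Defs.dim E = Defs.dim E'.
Proof.
move=> fK f_lin fE fE'.
have f_basis F F' n (b : 'I_n -> X) : (forall x, F x -> F' (f x)) ->
    (forall x, F' x -> F (f x)) -> is_basis F b -> is_basis F' (f \o b).
  move=> fF fF' [bF b_free b_gen]; split => [j|c|x F'x].
  - exact/fF/bF.
  - rewrite -(linear_comb f_lin) => /(congr1 f).
    by rewrite fK (linear_zero f_lin); exact: b_free.
  - have [c cx] := b_gen _ (fF' _ F'x); exists c.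
    by rewrite -(linear_comb f_lin) -cx fK.
have [/dim_pinftyP Eoo|] := pselect (Defs.dim E = +oo%E).
  have E'oo : Defs.dim E' = +oo%E.
    by apply/dim_pinftyP => n b /(f_basis _ E _ _ fE' fE); exact: Eoo.
  by rewrite E'oo; apply/dim_pinftyP.
move=> /dim_pinftyP/existsNP[n /existsNP[b /contrapT bE]].
by rewrite (dim_basis bE) (dim_basis (f_basis _ _ _ _ fE fE' bE)).
Qed.

(** If the kernel of f in E had a finite basis, adding to it a vector x0 of E with
    f x0 <> 0 would give a finite basis of E. *)
Lemma dim_kernel_pinfty E (f : X -> K^o) x0 :
  (forall a x y, f (a *: x + y) = a *: f x + f y) ->
  (forall a x y, E x -> E y -> E (a *: x + y)) ->
  E x0 -> f x0 != 0 -> Defs.dim E = +oo%E -> Defs.dim [set x | E x /\ f x = 0] = +oo%E.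
Proof.
move=> f_lin E_lin Ex0 fx0 /dim_pinftyP Eoo; apply/dim_pinftyP => n b.
move=> [bE b_free b_gen].
pose b' (j : 'I_n.+1) := if unlift ord0 j is Some i then b i else x0.
have b'0 : b' ord0 = x0 by rewrite /b' unlift_none.
have b'S i : b' (lift ord0 i) = b i by rewrite /b' liftK.
have sum_b' c : \sum_j c j *: b' j =
    c ord0 *: x0 + \sum_i c (lift ord0 i) *: b i.
  by rewrite big_ord_recl b'0; under eq_bigr do rewrite b'S.
apply: (Eoo _ b'); split => [j|c|x Ex].
- by case: (unliftP ord0 j) => [i|] ->; rewrite ?b'S ?b'0//; exact: (bE i).1.
- rewrite sum_b' => c0.
  have c00 : c ord0 = 0.
    have := congr1 f c0; rewrite f_lin (linear_comb f_lin) big1 => [|i _].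
      rewrite addr0 (linear_zero f_lin).
      by move=> /eqP; rewrite scaler_eq0 (negPf fx0) orbF => /eqP.
    by rewrite (bE i).2 scaler0.
  move: c0; rewrite c00 scale0r add0r => /b_free cS j.
  by case: (unliftP ord0 j) => [i|] ->.
- have [c cx] : exists c : 'I_n -> K,
      - (f x / f x0) *: x0 + x = \sum_(j < n) c j *: b j.
    apply: b_gen; split; first exact: E_lin.
    by rewrite f_lin /GRing.scale /= mulNr divfK// addNr.
  exists (fun j => if unlift ord0 j is Some i then c i else f x / f x0).
  rewrite sum_b' unlift_none; under eq_bigr do rewrite liftK.
  by rewrite -cx addrA -scalerDl subrr scale0r add0r.
Qed.

End dimension.

(** * Duality and the construction of other frames *)

Section constructions.
Context (R : realType) (k : base_kind).
Local Notation K := (base_field R k).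
Context (H : completeNormedModType K) (dot : {dot H for @base_conj R k}).
Context (norm_dot : forall x : H, `|x| ^+ 2 = dot x x).
Context (I : countType).
Local Notation rn := (@rnorm R k H).
Implicit Types (W V : I -> set H) (w v : I -> R) (c d : I -> H).

(** Q = T_V^* S_V^-1 S_W^-1 T_W, where T and T' are the inverses of the frame
    operators of W and V. *)
Lemma fusion_frames_Q_dual W w V v :
  fusion_frame dot W w -> fusion_frame dot V v -> Q_dual dot W w V v.
Proof.
move=> /(fusion_frameP dot)[Wsub _ [A [B [A0 B0 fB fA]]]] Vframe.
split=> //; move: Vframe => /(fusion_frameP dot)[Vsub _ [A' [B' [A'0 B'0 fB' fA']]]].
have [T [_ ST T_lin T_le]] := frame_operator_inverse norm_dot Wsub A0 B0 fB fA.
have [T' [ST' _ T'_lin T'_le]] :=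
  frame_operator_inverse norm_dot Vsub A'0 B'0 fB' fA'.
exists (fun c => analysis dot V v (T' (T (synthesis w c)))); split; last first.
  by move=> f; rewrite -[LHS]/(frame_operator dot V v _) ST' -[RHS]ST.
split=> [c _|a c d cW dW|].
- exact: (analysis_direct_sum norm_dot Vsub fB').
- rewrite (synthesis_linear norm_dot Wsub B0 fB)// T_lin T'_lin.
  exact: analysis_linear.
exists (Num.sqrt (B' * (A'^-1 * A^-1) ^+ 2 * B)) => c cW.
rewrite sqr_sqrtr; last first.
  by apply: mulr_ge0; [apply: mulr_ge0; [exact: ltW|exact: sqr_ge0]|exact: ltW].
have c_fin := sqnorm_fin_num cW.2.
rewrite -(fineK c_fin) -EFinM.
apply: le_trans (analysis_sqnorm_le norm_dot fB' _) _.
rewrite lee_fin -!(mulrA B') ler_pM2l// -[leRHS]mulrA.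
have s_le : rn (synthesis w c) ^+ 2 <= B * fine (sqnorm c).
  by apply: (synthesis_le norm_dot Wsub B0 fB) => //; rewrite fineK.
have A_ge0 : 0 <= A'^-1 * A^-1 by rewrite mulr_ge0 ?invr_ge0 ?ltW.
apply: (@le_trans _ _ ((A'^-1 * A^-1 * rn (synthesis w c)) ^+ 2)); last first.
  by rewrite exprMn ler_wpM2l ?sqr_ge0.
rewrite lerXn2r ?nnegrE ?rnorm_ge0 ?mulr_ge0 ?rnorm_ge0 ?invr_ge0 ?(ltW A0) ?(ltW A'0)//.
by apply: le_trans (T'_le _) _; rewrite -mulrA ler_wpM2l ?invr_ge0 ?(ltW A'0).
Qed.

Lemma sum_involution (Y : nmodType) (s : I -> I) (F : {fset I}) (x : I -> Y) :
  involutive s ->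
  \sum_(i <- F) x (s i) = \sum_(i <- [fset s i | i in F]%fset) x i.
Proof. by move=> sK; rewrite big_imfset//= => i j _ _; exact: (inv_inj sK). Qed.

(** Unconditional sums can be reordered: a finite set containing s @` A is mapped
    by s to a finite set containing A. *)
Lemma has_sum_involution (s : I -> I) (x : I -> H) t : involutive s ->
  has_sum x t -> has_sum (fun i => x (s i)) t.
Proof.
move=> sK xt; rewrite /has_sum.
under eq_fun do rewrite (sum_involution _ _ sK).
apply: (cvg_comp (fun F : {fset I} => [fset s i | i in F]%fset) _ _ xt).
move=> P [A _ AP]; exists [fset s i | i in A]%fset => // F /= AF; apply: AP => /=.
apply/fsubsetP => i iA; apply/imfsetP; exists (s i); last by rewrite sK.
by apply: (fsubsetP AF); apply/imfsetP; exists i.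
Qed.

Section permuted_frame.
Context (s : I -> I) (sK : involutive s) (w : I -> R) (M : R).
Context (w_gt0 : forall i, 0 < w i) (w_le : forall i, w i <= M * w (s i)).

Let w_sqr_le i : w i ^+ 2 <= M ^+ 2 * w (s i) ^+ 2.
Proof.
by rewrite -exprMn lerXn2r ?nnegrE ?(ltW (w_gt0 _))// (le_trans _ (w_le i)) ?ltW.
Qed.

Let frame_sum_permuted_le W F f :
  frame_sum dot (fun i => W (s i)) w F f <=
    M ^+ 2 * frame_sum dot W w [fset s i | i in F]%fset f.
Proof.
rewrite /frame_sum -(sum_involution _ _ sK) mulr_sumr; apply: ler_sum => i _.
by rewrite mulrA ler_wpM2r ?sqr_ge0.
Qed.

Lemma permuted_fusion_frame W : fusion_frame dot W w ->
  fusion_frame dot (fun i => W (s i)) w.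
Proof.
move=> /(fusion_frameP dot)[Wsub _ [A [B [A0 B0 fB fA]]]].
apply/(fusion_frameP dot); split => //.
have M20 : 0 <= M ^+ 2 by exact: sqr_ge0.
exists (A / (M ^+ 2 + 1)), (M ^+ 2 * B + 1); split.
- by rewrite divr_gt0// ltr_wpDl.
- by rewrite ltr_wpDl// mulr_ge0// ltW.
- move=> f F; apply: le_trans (frame_sum_permuted_le _ _ _) _.
  apply: (@le_trans _ _ (M ^+ 2 * (B * rn f ^+ 2))); first by rewrite ler_wpM2l.
  by rewrite mulrA ler_wpM2r ?sqr_ge0// lerDl.
move=> f m fm; have m0 : 0 <= m by have := fm fset0; rewrite /frame_sum big_seq_fset0.
rewrite mulrAC ler_pdivrMr ?ltr_wpDl//.
apply: (@le_trans _ _ (M ^+ 2 * m)); last by rewrite mulrC ler_wpM2l// lerDl.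
apply: fA => F; have := frame_sum_permuted_le (fun i => W (s i)) F f.
have -> : (fun i => W (s (s i))) = W by apply/funext => i; rewrite sK.
by move=> /le_trans; apply; rewrite ler_wpM2l.
Qed.

(** The factor w (s i) / w i compensates for the weights staying in place, so
    that the weighted family is only permuted. *)
Definition permute_vectors c : I -> H := fun i => of_real k (w (s i) / w i) *: c (s i).

Lemma permute_vectorsK : involutive permute_vectors.
Proof.
move=> c; apply/funext => i; rewrite /permute_vectors sK scalerA -of_realM.
rewrite (_ : _ / _ * _ = 1) ?of_real1 ?scale1r//.
by field; rewrite !gt_eqF.
Qed.

Lemma permute_vectors_null_space W c : fusion_frame dot W w ->
  null_space W w c -> null_space (fun i => W (s i)) w (permute_vectors c).
Proof.
move=> /(fusion_frameP dot)[Wsub _ [A [B [A0 B0 fB fA]]]] [cW c0].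
have cP := synthesis_has_sum norm_dot Wsub B0 fB cW.
split; last first.
  rewrite -c0; apply: sumE; have := has_sum_involution sK cP.
  congr (has_sum _ _); apply/funext => i; rewrite /permute_vectors scalerA -of_realM.
  by rewrite mulrC divfK ?gt_eqF.
split=> [i|]; first by apply: subspaceZ => //; exact: cW.1.
have c_fin := sqnorm_fin_num cW.2.
have c_le := sqnorm_psum_le (c := c) (M := fine (sqnorm c)).
apply: (@le_lt_trans _ _ (M ^+ 2 * fine (sqnorm c))%:E); last exact: ltry.
apply: esum_le_fset => F.
apply: (@le_trans _ _ (\sum_(i <- F) M ^+ 2 * rn (c (s i)) ^+ 2)).
  apply: ler_sum => i _; rewrite (rnorm_sqrZ norm_dot) ler_wpM2r ?sqr_ge0//.
  rewrite expr_div_n ler_pdivrMr ?exprn_gt0//.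
  by have := w_sqr_le (s i); rewrite sK.
rewrite -mulr_sumr (sum_involution _ (fun i => rn (c i) ^+ 2) sK).
by rewrite ler_wpM2l ?sqr_ge0// c_le// fineK.
Qed.

Lemma permuted_excess W : fusion_frame dot W w ->
  excess (fun i => W (s i)) w = excess W w.
Proof.
move=> Wframe; apply/esym/(dim_involution permute_vectorsK).
- move=> a c d; apply/funext => i; rewrite /permute_vectors /= scalerDr.
  by rewrite scalerA mulrC -scalerA.
- by move=> c; exact: permute_vectors_null_space.
- move=> c /(permute_vectors_null_space (permuted_fusion_frame Wframe)).
  by have -> : (fun i => W (s (s i))) = W by apply/funext => i; rewrite sK.
Qed.

End permuted_frame.

(** Closed as an intersection of zero sets of the continuous real functions
    Re <x, a u>. *)
Lemma closed_subspace_orthogonal (u : H) : closed_subspace [set x | dot x u = 0].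
Proof.
split=> [||a x y /= xu yu]; last first.
- by rewrite dotDl dotZl xu yu mulr0 addr0.
- by rewrite /= -(scale0r 0) dotZl mul0r.
rewrite (_ : mkset _ =
    \bigcap_(a in [set: K]) ((fun x => rdot dot x (a *: u)) @^-1` [set 0])).
  apply: closed_bigI => a _; apply: preimage_closed; last exact: closed_eq.
  by move=> x _; apply: (@cvg_rdot _ _ _ _ norm_dot _ (nbhs x) _ id x); exact: cvg_id.
apply/seteqP; split=> x /= xu => [a _|].
  by rewrite /= /rdot dotZr xu mulr0 -(of_real0 R k) of_realK.
by apply: base_re_mul_conj_eq0; rewrite mulrC -dotZr; exact: xu.
Qed.

Lemma proj_setT f : Defs.proj dot [set: H] f = f.
Proof.
have T_sub : closed_subspace [set: H] by split => //; exact: closedT.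
apply: (proj_unique norm_dot T_sub) => // h _.
by rewrite subrr -(scale0r 0) dotZl mul0r.
Qed.

(** When every subspace is H, a vanishing combination c with c i0 = u <> 0
    involves a second index i1.  Shrinking the subspace of index i0 to the
    hyperplane orthogonal to u preserves the lower frame bound, thanks to i1, and
    cuts the null space by the single equation <d i0, u> = 0, which c violates. *)
Lemma exists_hyperplane_frame (w : I -> R) :
  fusion_frame dot (fun=> [set: H]) w -> excess (H := H) (fun=> [set: H]) w = +oo%E ->
  exists V, [/\ fusion_frame dot V w, V <> (fun=> [set: H]) & excess V w = +oo%E].
Proof.
move=> Wframe Woo; have := Wframe.
move=> /(fusion_frameP dot)[Wsub w_gt0 [A [B [A0 B0 fB fA]]]].
have [c [cN c_neq0]] : exists c, null_space (fun=> [set: H]) w c /\ c <> 0.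
  apply: contrapT => /forallNP N0; move/dim_pinftyP : Woo => no_basis.
  apply: (no_basis 0%N (fun=> 0)); split=> [[]//|? ? []//|c cN]; exists (fun=> 0).
  by rewrite big_ord0; apply: contrapT => c0; exact: N0 c (conj cN c0).
have [i0 ci0] : exists i, c i <> 0.
  by apply: contrapT => /forallNP c0; apply: c_neq0; apply/funext => i; exact: contrapT.
have [i1 i10] : exists i1, i1 <> i0.
  apply: contrapT => /forallNP Ii0.
  have : has_sum (fun i => of_real k (w i) *: c i)
      (\sum_(i <- [fset i0]%fset) of_real k (w i) *: c i).
    by apply: has_sum_finite => i; rewrite (contrapT (Ii0 i)) !inE eqxx.
  move=> /sumE; rewrite -/(synthesis w c) cN.2 big_seq_fset1 => /esym/eqP.
  rewrite scaler_eq0 => /orP[|/eqP//].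
  by rewrite -(of_real0 R k) (inj_eq (can_inj (@of_realK R k))) gt_eqF.
pose u := c i0; pose V i := if i == i0 then [set x | dot x u = 0] else [set: H].
have u_neq0 : dot u u != 0.
  by rewrite -norm_dot sqrf_eq0 normr_eq0; apply/eqP.
have VT i : i <> i0 -> V i = [set: H] by move=> /eqP/negPf ii0; rewrite /V ii0.
have Vi0 : V i0 = [set x | dot x u = 0] by rewrite /V eqxx.
have Vsub i : closed_subspace (V i).
  have [->|/eqP/VT->] := eqVneq i i0; last exact: Wsub i.
  by rewrite Vi0; exact: closed_subspace_orthogonal.
exists V; split.
- apply/(fusion_frameP dot); split => //.
  exists (w i1 ^+ 2), B; split => //; first by rewrite exprn_gt0.
    move=> f F; apply: le_trans (fB f F); apply: ler_sum => i _.
    rewrite ler_wpM2l ?sqr_ge0// proj_setT lerXn2r ?nnegrE ?rnorm_ge0//.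
    exact: proj_le.
  move=> f m /(_ [fset i1]%fset).
  by rewrite /frame_sum big_seq_fset1 VT// proj_setT.
- move=> /(congr1 (fun V => V i0 u)); rewrite Vi0 /= => uu.
  by move/eqP : u_neq0; apply; rewrite uu.
have -> : excess V w = Defs.dim
    [set d | null_space (fun=> [set: H]) w d /\ dot (d i0) u = 0].
  congr (Defs.dim _); apply/seteqP; split=> d.
    move=> [[dV d_fin] d0]; split; first by split.
    by have := dV i0; rewrite Vi0.
  move=> [[[_ d_fin] d0] du]; split=> //; split=> // i.
  by have [->|/eqP/VT->//] := eqVneq i i0; rewrite Vi0.
apply: (@dim_kernel_pinfty _ _ _ _ (fun d => dot (d i0) u) c) => //.
- by move=> a x y /=; rewrite dotDl dotZl.
move=> a x y [xV x0] [yV y0]; split.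
  exact: direct_sum_linear.
by rewrite (synthesis_linear norm_dot Wsub B0 fB)// x0 y0 scaler0 addr0.
Qed.

(** Exchange two distinct subspaces if there are any.  If not, g = f - P f is
    orthogonal to the common value of the subspaces, so its frame sum vanishes
    and g = 0: that common value is H. *)
Lemma exists_other_frame W w : fusion_frame dot W w ->
  (exists i, W i <> [set: H]) \/ excess W w = +oo%E ->
  exists V, [/\ fusion_frame dot V w, V <> W & excess V w = excess W w].
Proof.
move=> Wframe nondeg; have := Wframe.
move=> /(fusion_frameP dot)[Wsub w_gt0 [A [B [A0 B0 fB fA]]]].
have [[i0 [i1 W01]]|W_cst] := pselect (exists i0 i1, W i0 <> W i1).
  pose s i := if i == i0 then i1 else if i == i1 then i0 else i.
  have i10 : i1 != i0 by apply/eqP => i10; apply: W01; rewrite i10.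
  have si0 : s i0 = i1 by rewrite /s eqxx.
  have si1 : s i1 = i0 by rewrite /s eqxx (negPf i10).
  have sid i : i != i0 -> i != i1 -> s i = i by rewrite /s => /negPf-> /negPf->.
  have sK : involutive s.
    move=> i; have [->|ii0] := eqVneq i i0; first by rewrite si0 si1.
    by have [->|ii1] := eqVneq i i1; [rewrite si1 si0|rewrite !sid].
  have w01 : 0 < w i0 / w i1 by rewrite divr_gt0.
  have w10 : 0 < w i1 / w i0 by rewrite divr_gt0.
  (* the constant bounds the ratio w i / w (s i), which is one of its terms *)
  have w_le i : w i <= (1 + w i0 / w i1 + w i1 / w i0) * w (s i).
    have [->|ii0] := eqVneq i i0.
      by rewrite si0 -ler_pdivrMr//; lra.
    have [->|ii1] := eqVneq i i1.
      by rewrite si1 -ler_pdivrMr//; lra.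
    by rewrite sid// ler_peMl ?ltW//; lra.
  exists (fun i => W (s i)); split.
  - exact: (permuted_fusion_frame sK w_gt0 w_le Wframe).
  - by move=> /(congr1 (fun V => V i0)); rewrite si0 => /esym.
  - exact: (permuted_excess sK w_gt0 w_le Wframe).
have Weq i j : W i = W j.
  by apply: contrapT => Wij; apply: W_cst; exists i, j.
have WT i : W i = [set: H].
  apply/seteqP; split=> // f _.
  suff : f - Defs.proj dot (W i) f = 0.
    by move=> /subr0_eq ->; exact: proj_in.
  set g := f - _; apply/eqP; rewrite -(@rnorm_eq0 R k) -sqrf_eq0 eq_le sqr_ge0.
  rewrite andbT -(ler_pM2l A0) mulr0; apply: fA => F.
  rewrite /frame_sum big1// => j _; rewrite (_ : Defs.proj _ _ _ = 0).
    by rewrite rnorm0 expr0n mulr0.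
  apply: (proj_unique norm_dot (Wsub j)); first by case: (Wsub j).
  by move=> h; rewrite (Weq j i) subr0; exact: (proj_spec norm_dot (Wsub i) f).2.
case: nondeg => [[i /(_ (WT i))//]|].
have -> : W = (fun=> [set: H]) by exact/funext.
move=> Woo; rewrite Woo; apply: exists_hyperplane_frame => //.
by have <- : W = (fun=> [set: H]) by exact/funext.
Qed.

End constructions.

Theorem proposition10 (R : realType) (k : base_kind)
    (H : completeNormedModType (base_field R k))
    (dot : {dot H for @base_conj R k})
    (norm_dot : forall x : H, `|x| ^+ 2 = dot x x)
    (separable_H : separable H)
    (I : countType) (W : I -> set H) (w : I -> R)
    (W_frame : fusion_frame dot W w)
    (W_nondegenerate : (exists i, W i <> [set: H]) \/ excess W w = +oo%E) :
  exists V : I -> set H,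
    [/\ Q_dual dot W w V w,
        V <> canonical_dual dot W w
      & excess V w = excess W w].
Proof.
have [Wcan|Wcan] := pselect (W = canonical_dual dot W w); last first.
  by exists W; split=> //; exact: fusion_frames_Q_dual.
have [V [V_frame VW VE]] := exists_other_frame norm_dot W_frame W_nondegenerate.
by exists V; split=> //; [exact: fusion_frames_Q_dual|rewrite -Wcan].
Qed.
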